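(* Let $V$ be a finite-dimensional complex vector space, $N\ge1$, $\boldsymbol z=(z_1,\dots,z_N)\in(\mathbb C^\times)^N$, $R\in\mathrm{Mer}(V^{\otimes2})$ and $D\in\mathrm{End}(V)$. Assume: (i) the Yang–Baxter equation $R_{12}(x/y)R_{13}(x)R_{23}(y)=R_{23}(y)R_{13}(x)R_{12}(x/y)$ in $\mathrm{End}(V^{\otimes3})$ for generic $x,y$; (ii) $[R(x),D\otimes D]=0$ in $\mathrm{End}(V\otimes V)$ for generic $x$; (iii) $R(1)\propto P$; (iv) $R$ is a polynomial in $x$ of degree $1$; (v) with respect to a certain ordered basis $(v_\alpha)_{\alpha=1}^n$ of $V$ we have, for all $\alpha,\beta\in\{1,\dots,n\}$, $$R(x)(v_\alpha\otimes v_\beta)\in\mathbb C\,v_\alpha\otimes v_\beta+\mathbb C\,v_\beta\otimes v_\alpha\ \text{ for all }x,\qquad R(0)(v_\alpha\otimes v_\beta)\in\sum_{\gamma\le\alpha,\ \delta\ge\beta}\mathbb C\,v_\gamma\otimes v_\delta,\qquad Dv_\alpha\in\mathbb C v_\alpha.$$ Let $$T(x;\boldsymbol z)=\mathrm{Tr}_0\,D_0\,R_{0N}(\tfrac{x}{z_N})\cdots R_{01}(\tfrac{x}{z_1})\in\mathrm{End}(V^{\otimes N}).$$ Then $[T(x;\boldsymbol z),T(y;\boldsymbol z)]=0$ for all $x,y\in\mathbb C$.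
   Context: $\mathrm{Mer}(V^{\otimes2})$ is the algebra of meromorphic functions $\mathbb C\to\mathrm{End}(V^{\otimes2})$. ''For generic $x,y$'' means outside a proper analytic subset. $X\propto Y$ means $X=mY$ with $m\in\mathbb C^\times$. $P\in\mathrm{GL}(V^{\otimes2})$ is the flip $P(v\otimes v')=v'\otimes v$. Tensor-leg notation: the subscripts of an operator indicate in which tensor factors (and in which order) it acts, with identity action in the others; the factor labelled $0$ is an auxiliary copy of $V$, and $1,\dots,N$ label the factors of $V^{\otimes N}$. $\mathrm{Tr}_0$ is the partial trace over the factor labelled $0$. *)

(* Defs.v *)
From HB Require Import structures.
From mathcomp Require Import all_boot all_order all_algebra.
From mathcomp Require Import complex.
From mathcomp Require Import boolp classical_sets reals topology normedtype.
From mathcomp Require Import derive.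

Set Implicit Arguments.
Unset Strict Implicit.
Unset Printing Implicit Defensive.

Import Order.TTheory GRing.Theory Num.Theory.
Import numFieldNormedType.Exports.

Local Open Scope ring_scope.
Local Open Scope complex_scope.
Local Open Scope classical_set_scope.

(** An abstract finite-dimensional [V] carries the reference basis
    [vbasis {:V}]; a tensor of order [N] is stored as its array of coordinates
    in the induced basis of the [N]-th tensor power.  The lemmas [pure_upd] and
    [pure_vbasis] say that [pure] is multilinear and sends the reference basis
    to a basis, so that [tpow V N] is the [N]-th tensor power of [V].  The
    operators below are characterised independently of the reference basis by
    their values on pure tensors ([leg1_pure], [flip_pure]) and by [leg2_leg1]
    and [ptrace0_leg1]. *)

Notation midx V N := {ffun 'I_N -> 'I_(\dim {:V})}.

Definition tpow (F : fieldType) (V : vectType F) (N : nat) : vectType F :=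
  {ffun midx V N -> F^o}.

Definition tcoef (F : fieldType) (V : vectType F) (N : nat) (t : tpow V N)
  (s : midx V N) : F := (t : {ffun midx V N -> F^o}) s.

Definition mktens (F : fieldType) (V : vectType F) (N : nat)
  (f : midx V N -> F) : tpow V N := [ffun s => f s : F^o].

Definition upd (I : eqType) (T : Type) (f : I -> T) (i : I) (x : T) : I -> T :=
  fun k => if k == i then x else f k.

Definition updi (F : fieldType) (V : vectType F) (N : nat) (s : midx V N)
  (i : 'I_N) (a : 'I_(\dim {:V})) : midx V N := [ffun k => upd s i a k].

Definition pairf (T : Type) (x y : T) : 'I_2 -> T :=
  fun k => if k == ord0 then x else y.

Definition pairi (F : fieldType) (V : vectType F) (a b : 'I_(\dim {:V})) :
  midx V 2 := [ffun k => pairf a b k].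

Definition pure (F : fieldType) (V : vectType F) (N : nat) (v : 'I_N -> V) :
  tpow V N := mktens (fun s => \prod_(i < N) coord (vbasis {:V}) (s i) (v i)).

Definition tens2 (F : fieldType) (V : vectType F) (v w : V) : tpow V 2 :=
  pure (pairf v w).

(** The vector (resp. the tensor of order 2) obtained from [t] by freezing all
    indices to those of [s], except the one at [i] (resp. those at [i], [j]). *)
Definition slice1 (F : fieldType) (V : vectType F) (N : nat) (i : 'I_N)
  (s : midx V N) (t : tpow V N) : V :=
  \sum_a tcoef t (updi s i a) *: (vbasis {:V})`_a.

Definition slice2 (F : fieldType) (V : vectType F) (N : nat) (i j : 'I_N)
  (s : midx V N) (t : tpow V N) : tpow V 2 :=
  mktens (fun u : midx V 2 => tcoef t (updi (updi s i (u ord0)) j (u ord_max))).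

Definition leg1_fun (F : fieldType) (V : vectType F) (N : nat) (i : 'I_N)
  (B : 'End(V)) (t : tpow V N) : tpow V N :=
  mktens (fun s => coord (vbasis {:V}) (s i) (B (slice1 i s t))).

Definition leg2_fun (F : fieldType) (V : vectType F) (N : nat) (i j : 'I_N)
  (A : 'End(tpow V 2)) (t : tpow V N) : tpow V N :=
  mktens (fun s => tcoef (A (slice2 i j s t)) (pairi (s i) (s j))).

(** [leg1 i B] is B_i and [leg2 i j A] is A_{ij} (for [i != j]). *)
Definition leg1 (F : fieldType) (V : vectType F) (N : nat) (i : 'I_N)
  (B : 'End(V)) : 'End(tpow V N) := linfun (leg1_fun i B).

Definition leg2 (F : fieldType) (V : vectType F) (N : nat) (i j : 'I_N)
  (A : 'End(tpow V 2)) : 'End(tpow V N) := linfun (leg2_fun i j A).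

Definition tensop (F : fieldType) (V : vectType F) (B C : 'End(V)) :
  'End(tpow V 2) := (leg1 ord0 B \o leg1 ord_max C)%VF.

Definition flip_fun (F : fieldType) (V : vectType F) (t : tpow V 2) :
  tpow V 2 := mktens (fun s => tcoef t (pairi (s ord_max) (s ord0))).

Definition flip (F : fieldType) (V : vectType F) : 'End(tpow V 2) :=
  linfun (@flip_fun F V).

(** In order N + 1 the factor 0 is [ord0], and the factors 1, ..., N are the
    [lift ord0 i] for [i : 'I_N]. *)
Definition consi (F : fieldType) (V : vectType F) (N : nat)
  (a : 'I_(\dim {:V})) (s : midx V N) : midx V N.+1 :=
  [ffun k => if unlift ord0 k is Some i then s i else a].

Definition taili (F : fieldType) (V : vectType F) (N : nat)
  (s : midx V N.+1) : midx V N := [ffun i => s (lift ord0 i)].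

(** The tensor e_a ⊗ t, for e_a the a-th vector of the reference basis. *)
Definition constens (F : fieldType) (V : vectType F) (N : nat)
  (a : 'I_(\dim {:V})) (t : tpow V N) : tpow V N.+1 :=
  mktens (fun s => if s ord0 == a then tcoef t (taili s) else 0).

Definition ptrace0_fun (F : fieldType) (V : vectType F) (N : nat)
  (A : 'End(tpow V N.+1)) (t : tpow V N) : tpow V N :=
  mktens (fun s => \sum_a tcoef (A (constens a t)) (consi a s)).

Definition ptrace0 (F : fieldType) (V : vectType F) (N : nat)
  (A : 'End(tpow V N.+1)) : 'End(tpow V N) := linfun (ptrace0_fun A).

(** Tr_0 D_0 R_{0N}(x / z_N) ... R_{01}(x / z_1); the entry z_{i+1} is [z i]. *)
Definition transfer (F : fieldType) (V : vectType F) (N : nat) (z : 'I_N -> F)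
  (R : F -> 'End(tpow V 2)) (D : 'End(V)) (x : F) : 'End(tpow V N) :=
  ptrace0
    (leg1 ord0 D \o
     \big[@comp_lfun _ _ _ _ / \1]_(i <- rev (enum 'I_N))
        leg2 ord0 (lift ord0 i) (R (x / z i)))%VF.

Definition yang_baxter (F : fieldType) (V : vectType F)
  (R : F -> 'End(tpow V 2)) (x y : F) : Prop :=
  let l1 : 'I_3 := @Ordinal 3 0 isT in
  let l2 : 'I_3 := @Ordinal 3 1 isT in
  let l3 : 'I_3 := @Ordinal 3 2 isT in
  (leg2 l1 l2 (R (x / y)) \o leg2 l1 l3 (R x) \o leg2 l2 l3 (R y) =
   leg2 l2 l3 (R y) \o leg2 l1 l3 (R x) \o leg2 l1 l2 (R (x / y)))%VF.

Definition propto (F : fieldType) (E : lmodType F) (X Y : E) : Prop :=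
  exists2 m : F, m != 0 & X = m *: Y.

Definition poly_deg1 (F : fieldType) (E : lmodType F) (f : F -> E) : Prop :=
  exists A B : E, B != 0 /\ forall x, f x = A + x *: B.

Lemma tcoef_mktens (F : fieldType) (V : vectType F) N (f : midx V N -> F) s :
  tcoef (mktens f) s = f s.
Proof. by rewrite /tcoef /mktens ffunE. Qed.

Lemma tensP (F : fieldType) (V : vectType F) N (t u : tpow V N) :
  (forall s, tcoef t s = tcoef u s) -> t = u.
Proof.
by move=> h; apply: (iffLR (@ffunP _ _ (t : {ffun midx V N -> F^o}) u)) => s; apply: h.
Qed.

Lemma tcoefP (F : fieldType) (V : vectType F) N (a : F) (t u : tpow V N) s :
  tcoef (a *: t + u) s = a * tcoef t s + tcoef u s.
Proof. by rewrite /tcoef !ffunE. Qed.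

Lemma mktens_lin (F : fieldType) (V : vectType F) N (a : F)
    (f g h : midx V N -> F) :
  (forall s, f s = a * g s + h s) ->
  mktens f = a *: mktens g + mktens h :> tpow V N.
Proof.
by move=> fE; apply: tensP => s; rewrite tcoefP !tcoef_mktens fE.
Qed.

Lemma slice1_linear (F : fieldType) (V : vectType F) N (i : 'I_N) s :
  linear (@slice1 F V N i s).
Proof.
move=> a t u; rewrite /slice1 scaler_sumr -big_split /=.
by apply: eq_bigr => b _; rewrite tcoefP scalerDl scalerA.
Qed.

Lemma slice2_linear (F : fieldType) (V : vectType F) N (i j : 'I_N) s :
  linear (@slice2 F V N i j s).
Proof.
by move=> a t u; apply: mktens_lin => p; rewrite tcoefP.
Qed.

Lemma constens_linear (F : fieldType) (V : vectType F) N a :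
  linear (@constens F V N a).
Proof.
move=> c t u; apply: mktens_lin => p.
by case: ifP => _; rewrite ?tcoefP // mulr0 addr0.
Qed.

Lemma leg1_fun_linear (F : fieldType) (V : vectType F) N (i : 'I_N) B :
  linear (@leg1_fun F V N i B).
Proof.
move=> a t u; apply: mktens_lin => p.
by rewrite slice1_linear !linearP.
Qed.

Lemma leg2_fun_linear (F : fieldType) (V : vectType F) N (i j : 'I_N) A :
  linear (@leg2_fun F V N i j A).
Proof.
move=> a t u; apply: mktens_lin => p.
by rewrite slice2_linear linearP tcoefP.
Qed.

Lemma flip_fun_linear (F : fieldType) (V : vectType F) :
  linear (@flip_fun F V).
Proof.
by move=> a t u; apply: mktens_lin => p; rewrite tcoefP.
Qed.

Lemma ptrace0_fun_linear (F : fieldType) (V : vectType F) N A :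
  linear (@ptrace0_fun F V N A).
Proof.
move=> a t u; apply: mktens_lin => p.
rewrite mulr_sumr -big_split /=; apply: eq_bigr => b _.
by rewrite constens_linear linearP tcoefP.
Qed.

Lemma linfunP (F : fieldType) (U W : vectType F) (f : U -> W) :
  linear f -> forall u, linfun f u = f u.
Proof.
move=> lf u.
pose g : {linear U -> W} := HB.pack f (GRing.isLinear.Build F U W *:%R f lf).
by rewrite -[f]/(g : U -> W) lfunE.
Qed.

Lemma leg1E (F : fieldType) (V : vectType F) N (i : 'I_N) B (t : tpow V N) s :
  tcoef (leg1 i B t) s = coord (vbasis {:V}) (s i) (B (slice1 i s t)).
Proof. by rewrite linfunP ?tcoef_mktens //; apply: leg1_fun_linear. Qed.

Lemma leg2E (F : fieldType) (V : vectType F) N (i j : 'I_N) A (t : tpow V N) s :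
  tcoef (leg2 i j A t) s = tcoef (A (slice2 i j s t)) (pairi (s i) (s j)).
Proof. by rewrite linfunP ?tcoef_mktens //; apply: leg2_fun_linear. Qed.

Lemma flipE (F : fieldType) (V : vectType F) (t : tpow V 2) s :
  tcoef (flip V t) s = tcoef t (pairi (s ord_max) (s ord0)).
Proof. by rewrite linfunP ?tcoef_mktens //; apply: flip_fun_linear. Qed.

Lemma ptrace0E (F : fieldType) (V : vectType F) N A (t : tpow V N) s :
  tcoef (ptrace0 A t) s = \sum_a tcoef (A (constens a t)) (consi a s).
Proof. by rewrite linfunP ?tcoef_mktens //; apply: ptrace0_fun_linear. Qed.

Lemma pure_upd (F : fieldType) (V : vectType F) N (v : 'I_N -> V) i a x y :
  pure (upd v i (a *: x + y)) = a *: pure (upd v i x) + pure (upd v i y).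
Proof.
apply: mktens_lin => s.
have E w : \prod_(k < N) coord (vbasis {:V}) (s k) (upd v i w k) =
    coord (vbasis {:V}) (s i) w *
    \prod_(k < N | k != i) coord (vbasis {:V}) (s k) (v k).
  rewrite (bigD1 i) //= /upd eqxx; congr (_ * _).
  by apply: eq_bigr => k /negbTE->.
by rewrite !E linearP mulrDl -mulrA.
Qed.

Lemma pure_vbasis (F : fieldType) (V : vectType F) N (s0 : midx V N) :
  pure (fun i => (vbasis {:V})`_(s0 i)) = mktens (fun s => (s == s0)%:R).
Proof.
apply: tensP => s; rewrite !tcoef_mktens.
transitivity (\prod_(i < N) (s i == s0 i)%:R : F).
  apply: eq_bigr => i _; rewrite coord_free; first by rewrite -val_eqE eq_sym.
  exact: basis_free (vbasisP fullv).
have [->|ne] := eqVneq s s0; first by rewrite big1 // => i _; rewrite eqxx.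
have /existsP[i hi] : [exists i, s i != s0 i].
  rewrite -negb_forall; apply: contra ne => /forallP h.
  by apply/eqP/ffunP => i; apply/eqP.
by rewrite (bigD1 i) //= (negbTE hi) mul0r.
Qed.

Lemma slice1_pure (F : fieldType) (V : vectType F) N (i : 'I_N) s
    (v : 'I_N -> V) :
  slice1 i s (pure v) =
  (\prod_(k < N | k != i) coord (vbasis {:V}) (s k) (v k)) *: v i.
Proof.
rewrite /slice1 [v i in RHS](coord_vbasis (memvf (v i))) scaler_sumr.
apply: eq_bigr => a _; rewrite scalerA; congr (_ *: _).
rewrite tcoef_mktens (bigD1 i) //= mulrC ffunE /upd eqxx; congr (_ * _).
by apply: eq_bigr => k /negbTE kn; rewrite ffunE /upd kn.
Qed.

Lemma leg1_pure (F : fieldType) (V : vectType F) N (i : 'I_N) (B : 'End(V))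
    (v : 'I_N -> V) :
  leg1 i B (pure v) = pure (upd v i (B (v i))).
Proof.
apply: tensP => s; rewrite leg1E slice1_pure !linearZ /= tcoef_mktens.
rewrite [RHS](bigD1 i) //= /upd eqxx mulrC; congr (_ * _).
by apply: eq_bigr => k /negbTE->.
Qed.

Lemma tensop_pure (F : fieldType) (V : vectType F) (B C : 'End(V)) v w :
  tensop B C (tens2 v w) = tens2 (B v) (C w).
Proof.
rewrite /tensop comp_lfunE /tens2 !leg1_pure; congr pure; apply/funext => k.
by rewrite /upd /pairf; case: k => [[|[|k]] hk].
Qed.

Lemma flip_pure (F : fieldType) (V : vectType F) (v w : V) :
  flip V (tens2 v w) = tens2 w v.
Proof.
apply: tensP => s; rewrite flipE !tcoef_mktens !big_ord_recl !big_ord0 /=.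
by rewrite !mulr1 !ffunE /pairf /= mulrC; do 4 f_equal; apply: val_inj.
Qed.

Lemma leg2_leg1 (F : fieldType) (V : vectType F) N (i j : 'I_N) (B C : 'End(V)) :
  i != j -> leg2 i j (tensop B C) = (leg1 i B \o leg1 j C)%VF.
Proof.
move=> neq; apply/lfunP => t; apply: tensP => s.
rewrite leg2E /tensop !comp_lfunE !leg1E ffunE /pairf eqxx.
congr (coord _ _ (B _)); apply: eq_bigr => a _; congr (_ *: _).
rewrite !leg1E.
have -> : updi (pairi (s i) (s j)) ord0 a ord_max = s j.
  by rewrite !ffunE /upd /= !ffunE.
have -> : updi s i a j = s j by rewrite ffunE /upd eq_sym (negbTE neq).
congr (coord _ _ (C _)); apply: eq_bigr => b _; congr (_ *: _).
by rewrite tcoef_mktens !ffunE /upd /= !ffunE /upd.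
Qed.

Lemma ptrace0_leg1 (F : fieldType) (V : vectType F) N (i : 'I_N)
    (B C : 'End(V)) :
  ptrace0 (leg1 ord0 B \o leg1 (lift ord0 i) C)%VF =
  (\sum_a coord (vbasis {:V}) a (B (vbasis {:V})`_a)) *: leg1 i C.
Proof.
apply/lfunP => t; apply: tensP => s; rewrite ptrace0E.
transitivity ((\sum_a coord (vbasis {:V}) a (B (vbasis {:V})`_a)) *
    tcoef (leg1 i C t) s); last first.
  by rewrite scale_lfunE /tcoef ffunE.
rewrite mulr_suml; apply: eq_bigr => a _; rewrite comp_lfunE leg1E.
have -> : consi a s ord0 = a by rewrite ffunE unlift_none.
have -> : slice1 ord0 (consi a s) (leg1 (lift ord0 i) C (constens a t)) =
    tcoef (leg1 i C t) s *: (vbasis {:V})`_a; last first.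
  by rewrite !linearZ /= mulrC.
rewrite /slice1 (bigD1 a) //= big1 ?addr0 => [|b ba].
  rewrite !leg1E; congr (_ *: _).
  rewrite ffunE /upd /= ffunE liftK; congr (coord _ _ (C _)).
  apply: eq_bigr => c _; rewrite tcoef_mktens !ffunE /upd /= !ffunE eqxx.
  congr (tcoef _ _ *: _); apply/ffunP => k; rewrite !ffunE /upd.
  by rewrite (inj_eq lift_inj) ffunE /upd /= ffunE liftK.
rewrite leg1E [slice1 _ _ _]big1 ?linear0 ?scale0r // => c _.
by rewrite tcoef_mktens !ffunE /upd /= ffunE /upd /= (negbTE ba) scale0r.
Qed.

(** The value of [f] at a pole is arbitrary. *)
Definition meromorphic (K : realType) (f : K[i] -> K[i]) : Prop :=
  forall p : K[i]^o, exists (k : nat) (g : K[i]^o -> K[i]^o),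
    (\forall x \near p, derivable g x 1) /\
    (\forall x \near p^', f x = g x / (x - p) ^+ k).

Definition mer_End (K : realType) (E : vectType K[i]) (f : K[i] -> 'End(E)) :
  Prop :=
  forall a b, meromorphic (fun x => coord (vbasis {:E}) b (f x (vbasis {:E})`_a)).

(** [A] is an analytic subset of the open set [O]: locally at every point of
    [O], the common zero locus of finitely many holomorphic (that is, complex
    differentiable) functions. *)
Definition analytic_subset (K : realType) (E : normedModType K[i])
  (O A : set E) : Prop :=
  A `<=` O /\
  forall p, O p -> exists U : set E,
    [/\ open_nbhs p U, U `<=` O &
      exists (m : nat) (f : 'I_m -> E -> K[i]^o),
        (forall i q, U q -> differentiable (f i) q) /\
        (forall q, U q -> (A q <-> forall i, f i q = 0))].

(** [P] holds on the (connected) open set [O] outside a proper analytic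
    subset of [O]. *)
Definition generic (K : realType) (E : normedModType K[i]) (O : set E)
  (P : E -> Prop) : Prop :=
  exists A : set E,
    [/\ analytic_subset O A, A <> O & forall p, O p -> ~ A p -> P p].

(* Main.v *)
Require Import Defs.
From HB Require Import structures.
From mathcomp Require Import all_boot all_order all_algebra.
From mathcomp Require Import complex.
From mathcomp Require Import boolp classical_sets reals topology normedtype.
From mathcomp Require Import derive.
From mathcomp Require Import ring.

(** Writing the monodromy D_0 R_{0N} ... R_{01} as a matrix of operators on
    V^{⊗N} indexed by a basis of the auxiliary space, the Yang-Baxter equation
    and [R, D ⊗ D] = 0 give r X_0 Y_{0'} = Y_{0'} X_0 r with r = R(x / y), a
    relation stable under multiplication of matrices whose entries at different
    sites commute.  When r is invertible, conjugating by r and taking the trace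
    shows that T(x) and T(y) commute.  Invertibility fails only at the zeros of
    det R(x / y), which is a nonzero polynomial because R(1) is a multiple of
    the flip; as T is polynomial, commutation extends to all x and y.  The
    generic hypotheses hold on a nonempty open set, hence identically since R
    is polynomial. *)

Set Implicit Arguments.
Unset Strict Implicit.
Unset Printing Implicit Defensive.

Import Order.TTheory GRing.Theory Num.Theory.
Import numFieldNormedType.Exports.

Local Open Scope ring_scope.
Local Open Scope complex_scope.
Local Open Scope classical_set_scope.

(** * Exchange relations for matrices with operator entries *)

Section Exchange.
Variables (F : fieldType) (I : finType) (W : vectType F).
Implicit Types (r : I * I -> I * I -> F) (X Y : I -> I -> 'End(W)).

Lemma comp_lfun_suml (J : finType) (f : J -> 'End(W)) (g : 'End(W)) :
  ((\sum_j f j) \o g = \sum_j (f j \o g))%VF.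
Proof.
apply/lfunP => u; rewrite comp_lfunE !sum_lfunE.
by apply: eq_bigr => j _; rewrite comp_lfunE.
Qed.

Lemma comp_lfun_sumr (J : finType) (f : J -> 'End(W)) (g : 'End(W)) :
  (g \o (\sum_j f j) = \sum_j (g \o f j))%VF.
Proof.
apply/lfunP => u; rewrite comp_lfunE !sum_lfunE linear_sum.
by apply: eq_bigr => j _; rewrite comp_lfunE.
Qed.

(* r_{00'} X_0 Y_{0'} = Y_{0'} X_0 r_{00'}, for [r] a scalar matrix on two copies
   of the auxiliary space and [X], [Y] operator-valued matrices on one copy. *)
Definition rtt r X Y : Prop := forall p q : I * I,
  \sum_c r p c *: (X c.1 q.1 \o Y c.2 q.2)%VF =
  \sum_c r c q *: (Y p.2 c.2 \o X p.1 c.1)%VF.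

Definition mprod X Y : I -> I -> 'End(W) :=
  fun a b => \sum_c (X a c \o Y c b)%VF.

Definition mtrace X : 'End(W) := \sum_a X a a.

Definition scalmx (m : I -> I -> F) : I -> I -> 'End(W) :=
  fun a b => m a b *: \1%VF.

(** Moving [X'] past [Y] makes [X], [Y] adjacent and [X'], [Y'] adjacent; the two summation indices
    merge into one pair. *)
Lemma mprod_comp X X' Y Y' a b c d :
  (forall u v, X' u b \o Y c v = Y c v \o X' u b)%VF ->
  (mprod X X' a b \o mprod Y Y' c d)%VF =
  \sum_(w : I * I) ((X a w.1 \o Y c w.2) \o (X' w.1 b \o Y' w.2 d))%VF.
Proof.
move=> XY; rewrite /mprod comp_lfun_suml.
under eq_bigr => u _ do rewrite comp_lfun_sumr.
rewrite pair_bigA /=; apply: eq_bigr => -[u v] _ /=.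
by rewrite -!comp_lfunA; congr comp_lfun; rewrite !comp_lfunA XY.
Qed.

(** Regroup (X X')(Y Y') as (X Y)(X' Y'), let [r] pass the first pair, then the second, and regroup
    back. Each commutation hypothesis serves one of the two regroupings. *)
Lemma rtt_mprod r X Y X' Y' :
  rtt r X Y -> rtt r X' Y' ->
  (forall a b c d, X' a b \o Y c d = Y c d \o X' a b)%VF ->
  (forall a b c d, X a b \o Y' c d = Y' c d \o X a b)%VF ->
  rtt r (mprod X X') (mprod Y Y').
Proof.
move=> h h' XY' YX' p q.
transitivity (\sum_(w : I * I) \sum_c (r p c *: (X c.1 w.1 \o Y c.2 w.2)
    \o (X' w.1 q.1 \o Y' w.2 q.2))%VF).
  rewrite exchange_big /=; apply: eq_bigr => c _.
  rewrite mprod_comp // scaler_sumr; apply: eq_bigr => w _.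
  by rewrite comp_lfunZl.
transitivity (\sum_(w : I * I) \sum_c (r c w *: (Y p.2 c.2 \o X p.1 c.1)
    \o (X' w.1 q.1 \o Y' w.2 q.2))%VF).
  by apply: eq_bigr => w _; rewrite -!comp_lfun_suml h.
rewrite exchange_big /=.
transitivity (\sum_(c : I * I) ((Y p.2 c.2 \o X p.1 c.1)
    \o (\sum_w r w q *: (Y' c.2 w.2 \o X' c.1 w.1)))%VF).
  apply: eq_bigr => c _; rewrite -(h' c q) comp_lfun_sumr.
  by apply: eq_bigr => w _; rewrite -comp_lfunZl comp_lfunZr.
under [LHS]eq_bigr => c _ do rewrite comp_lfun_sumr.
rewrite exchange_big /=; apply: eq_bigr => w _.
rewrite mprod_comp => [|u v]; last by rewrite YX'.
rewrite scaler_sumr.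
(* With [Y] in front, [mprod_comp] lists the [Y] index before the [X] index, hence the swap. *)
rewrite [RHS](reindex_inj (h := fun c : I * I => (c.2, c.1))) /=.
  by apply: eq_bigr => c _; rewrite -comp_lfunZr.
by move=> [u v] [u' v'] [-> ->].
Qed.

(** The hypothesis says that [r] commutes with m ⊗ m; the entries being scalars, the opposite order
    of the factors in [rtt] makes no difference. *)
Lemma rtt_scalmx r (m : I -> I -> F) :
  (forall p q, \sum_c r p c * (m c.1 q.1 * m c.2 q.2) =
               \sum_c r c q * (m p.1 c.1 * m p.2 c.2)) ->
  rtt r (scalmx m) (scalmx m).
Proof.
move=> h p q; rewrite /scalmx.
have E (k k' k'' : F) : k *: (k' *: \1%VF \o k'' *: \1%VF)%VF =
    (k * (k' * k'')) *: \1%VF :> 'End(W).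
  by rewrite -comp_lfunZl -comp_lfunZr comp_lfun1l !scalerA.
under eq_bigr do rewrite E; rewrite -scaler_suml h scaler_suml.
by apply: eq_bigr => c _; rewrite E [m p.2 _ * _]mulrC.
Qed.

(** Insert r' r = 1 under the trace over both auxiliary spaces, carry [r] through X_0 Y_{0'}, and
    cancel it against [r'] by cyclicity. *)
Lemma rtt_trace_comm r r' X Y :
  (forall p q, \sum_c r p c * r' c q = (p == q)%:R) ->
  (forall p q, \sum_c r' p c * r c q = (p == q)%:R) ->
  rtt r X Y -> (mtrace X \o mtrace Y = mtrace Y \o mtrace X)%VF.
Proof.
move=> rr' r'r h.
have E (A B : I -> I -> 'End(W)) :
    (mtrace A \o mtrace B = \sum_(p : I * I) (A p.1 p.1 \o B p.2 p.2))%VF.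
  rewrite /mtrace comp_lfun_suml -(pair_bigA _ (fun a b => A a a \o B b b)%VF) /=.
  by apply: eq_bigr => a _; rewrite comp_lfun_sumr.
have delta (A : I * I -> 'End(W)) p : \sum_c (p == c)%:R *: A c = A p.
  rewrite (bigD1 p) //= eqxx scale1r big1 ?addr0 // => c.
  by rewrite eq_sym => /negbTE->; rewrite scale0r.
rewrite !E.
transitivity (\sum_p \sum_s \sum_c (r' p s * r s c) *: (X c.1 p.1 \o Y c.2 p.2)%VF).
  apply: eq_bigr => p _; rewrite exchange_big /=.
  rewrite -[LHS](delta (fun c => X c.1 p.1 \o Y c.2 p.2)%VF).
  by apply: eq_bigr => c _; rewrite -r'r scaler_suml.
transitivity (\sum_p \sum_s \sum_c (r' p s * r c p) *: (Y s.2 c.2 \o X s.1 c.1)%VF).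
  apply: eq_bigr => p _; apply: eq_bigr => s _.
  under eq_bigr => c _ do rewrite -scalerA.
  under [RHS]eq_bigr => c _ do rewrite -scalerA.
  by rewrite -!scaler_sumr h.
(* Cyclicity of the trace: the entries of [r] and [r'] are scalars, so exchanging the sums forms r
   r'. *)
rewrite exchange_big /=.
transitivity (\sum_(p : I * I) (Y p.2 p.2 \o X p.1 p.1)%VF).
  apply: eq_bigr => s _; rewrite exchange_big /=.
  rewrite -[RHS](delta (fun c => Y s.2 c.2 \o X s.1 c.1)%VF).
  apply: eq_bigr => c _; rewrite -scaler_suml eq_sym -rr'.
  by congr (_ *: _); apply: eq_bigr => p _; rewrite mulrC.
by rewrite (reindex_inj (h := fun c : I * I => (c.2, c.1))) // => -[u v] [u' v'] [-> ->].
Qed.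

End Exchange.

(** * Coordinates on tensor powers, and operators as block matrices along factor 0 *)

Section Tensors.
Variables (F : fieldType) (V : vectType F).
Local Notation I := 'I_(\dim {:V}).
Local Notation e := (vbasis {:V}).

Definition delta N (s0 : midx V N) : tpow V N := mktens (fun s => (s == s0)%:R).

Lemma coord_e (a b : I) : coord e a e`_b = (a == b)%:R.
Proof.
rewrite coord_free; first by rewrite -val_eqE eq_sym.
exact: basis_free (vbasisP fullv).
Qed.

Lemma tcoef_sum N (J : finType) (f : J -> tpow V N) s :
  tcoef (\sum_j f j) s = \sum_j tcoef (f j) s.
Proof. by rewrite /tcoef sum_ffunE. Qed.

Lemma tcoefZ N k (t : tpow V N) s : tcoef (k *: t) s = k * tcoef t s.
Proof. by rewrite /tcoef ffunE. Qed.

Lemma delta_sum N (t : tpow V N) : t = \sum_s tcoef t s *: delta s.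
Proof.
apply: tensP => s; rewrite tcoef_sum (bigD1 s) //= big1 => [|s' ne].
  by rewrite tcoefZ tcoef_mktens eqxx mulr1 addr0.
by rewrite tcoefZ tcoef_mktens eq_sym (negbTE ne) mulr0.
Qed.

(** The tensors [delta] span, and each is a pure tensor of reference basis vectors. *)
Lemma eq_on_pure N (A B : 'End(tpow V N)) :
  (forall v : 'I_N -> V, A (pure v) = B (pure v)) -> A = B.
Proof.
move=> AB; apply/lfunP => t; rewrite [t]delta_sum !linear_sum.
by apply: eq_bigr => s _; rewrite !linearZ /= /delta -pure_vbasis AB.
Qed.

Lemma eq_on_basis (f g : 'End(V)) :
  (forall k l : I, coord e k (f e`_l) = coord e k (g e`_l)) -> f = g.
Proof.
move=> fg; apply/lfunP => v; rewrite [v](coord_vbasis (memvf v)) !linear_sum.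
apply: eq_bigr => l _; rewrite !linearZ /=; congr (_ *: _).
rewrite (coord_vbasis (memvf (f e`_l))) [RHS](coord_vbasis (memvf (g e`_l))).
by apply: eq_bigr => k _; rewrite fg.
Qed.

Lemma coord_comp (f g : 'End(V)) (k l : I) :
  coord e k ((f \o g)%VF e`_l) = \sum_(m : I) coord e k (f e`_m) * coord e m (g e`_l).
Proof.
rewrite comp_lfunE [g e`_l](coord_vbasis (memvf _)) !linear_sum.
by apply: eq_bigr => m _; rewrite !linearZ mulrC -coord_vbasis ?memvf.
Qed.

Lemma leg1_comp N (i : 'I_N) (B C : 'End(V)) :
  leg1 i (B \o C)%VF = (leg1 i B \o leg1 i C)%VF.
Proof.
apply: eq_on_pure => v; rewrite comp_lfunE !leg1_pure comp_lfunE /upd eqxx.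
by congr pure; apply/funext => k; case: (k == i).
Qed.

Lemma leg1_comm N (i j : 'I_N) (B C : 'End(V)) : i != j ->
  (leg1 i B \o leg1 j C = leg1 j C \o leg1 i B)%VF.
Proof.
move=> ij; apply: eq_on_pure => v; rewrite !comp_lfunE !leg1_pure.
congr pure; apply/funext => k; rewrite /upd [j == i]eq_sym (negbTE ij).
by case: (k =P i) => // ->; rewrite (negbTE ij).
Qed.

Lemma leg1_linear N (i : 'I_N) : linear (@leg1 F V N i).
Proof.
move=> a B C; apply/lfunP => t; apply: tensP => s.
by rewrite add_lfunE scale_lfunE tcoefP !leg1E add_lfunE scale_lfunE linearP.
Qed.

HB.instance Definition _ N (i : 'I_N) :=
  GRing.isLinear.Build F _ _ *:%R (@leg1 F V N i) (@leg1_linear N i).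

(** Factor 0 is the auxiliary space: [A] becomes a matrix over End(V^{⊗N}) with row index [a] and
    column index [b]. *)
Definition block_fun N (A : 'End(tpow V N.+1)) (a b : I) (t : tpow V N) :
  tpow V N := mktens (fun s => tcoef (A (constens b t)) (consi a s)).

Definition block N (A : 'End(tpow V N.+1)) (a b : I) : 'End(tpow V N) :=
  linfun (block_fun A a b).

Lemma blockE N (A : 'End(tpow V N.+1)) a b t s :
  tcoef (block A a b t) s = tcoef (A (constens b t)) (consi a s).
Proof.
rewrite linfunP ?tcoef_mktens // => c u v; apply: mktens_lin => p.
by rewrite constens_linear linearP tcoefP.
Qed.

Lemma ptrace0_block N (A : 'End(tpow V N.+1)) : ptrace0 A = mtrace (block A).
Proof.
apply/lfunP => t; apply: tensP => s; rewrite ptrace0E sum_lfunE tcoef_sum.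
by apply: eq_bigr => a _; rewrite blockE.
Qed.

Lemma consi_taili N (s : midx V N.+1) : consi (s ord0) (taili s) = s.
Proof.
apply/ffunP => k; rewrite ffunE; case: unliftP => [i|] -> //.
by rewrite ffunE.
Qed.

Lemma consi0 N a (s : midx V N) : consi a s ord0 = a.
Proof. by rewrite ffunE unlift_none. Qed.

Lemma consiS N a (s : midx V N) i : consi a s (lift ord0 i) = s i.
Proof. by rewrite ffunE liftK. Qed.

Lemma constens_sum N (u : tpow V N.+1) :
  u = \sum_b constens b (mktens (fun s => tcoef u (consi b s))).
Proof.
apply: tensP => s; rewrite tcoef_sum (bigD1 (s ord0)) //= big1 => [|b ne].
  by rewrite !tcoef_mktens eqxx consi_taili addr0.
by rewrite tcoef_mktens eq_sym (negbTE ne).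
Qed.

(** Expanding the image of e_b ⊗ t under [B] along the basis of factor 0 produces the sum over the
    middle index. *)
Lemma block_comp N (A B : 'End(tpow V N.+1)) :
  block (A \o B)%VF = mprod (block A) (block B).
Proof.
apply/funext => a; apply/funext => b; apply/lfunP => t; apply: tensP => s.
rewrite blockE comp_lfunE [B _]constens_sum linear_sum sum_lfunE !tcoef_sum.
apply: eq_bigr => c _; rewrite comp_lfunE blockE; congr (tcoef (A (constens _ _)) _).
by apply: tensP => s'; rewrite tcoef_mktens blockE.
Qed.

(** Treats operators acting on factor 0 alone; it serves for the identity and for D_0. *)
Lemma block_scalar N (A : 'End(tpow V N.+1)) (m : I -> I -> F) :
  (forall u s, tcoef (A u) s = \sum_b m (s ord0) b * tcoef u (consi b (taili s))) ->
  block A = scalmx (tpow V N) m.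
Proof.
move=> h; apply/funext => a; apply/funext => b; apply/lfunP => t; apply: tensP => s.
have ts c : taili (consi c s) = s by apply/ffunP => i; rewrite ffunE consiS.
rewrite blockE h scale_lfunE id_lfunE tcoefZ consi0 ts (bigD1 b) //= big1.
  by rewrite tcoef_mktens consi0 eqxx ts addr0.
by move=> c ne; rewrite tcoef_mktens consi0 (negbTE ne) mulr0.
Qed.

Lemma block_id N : block (\1%VF : 'End(tpow V N.+1)) =
  scalmx (tpow V N) (fun a b => (a == b)%:R).
Proof.
apply: block_scalar => u s; rewrite id_lfunE (bigD1 (s ord0)) //= eqxx mul1r.
rewrite consi_taili big1 ?addr0 // => c.
by rewrite eq_sym => /negbTE->; rewrite mul0r.
Qed.

Lemma block_leg1 N (B : 'End(V)) : block (leg1 (ord0 : 'I_N.+1) B) =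
  scalmx (tpow V N) (fun a b => coord e a (B e`_b)).
Proof.
apply: block_scalar => u s; rewrite leg1E linear_sum linear_sum.
apply: eq_bigr => b _; rewrite !linearZ /= mulrC; congr (_ * tcoef _ _).
apply/ffunP => k; rewrite ffunE /upd; case: (unliftP ord0 k) => [i|] ->.
  by rewrite consiS ffunE.
by rewrite consi0 eqxx.
Qed.

(** The matrix of [A] indexed by pairs, as [rtt] expects of [r]. *)
Definition opcoef (A : 'End(tpow V 2)) (p q : I * I) : F :=
  tcoef (A (delta (pairi q.1 q.2))) (pairi p.1 p.2).

Lemma pairi_bij : bijective (fun p : I * I => pairi p.1 p.2).
Proof.
exists (fun s : midx V 2 => (s ord0, s ord_max)) => [[a b]|s] /=.
  by rewrite !ffunE.
apply/ffunP => k; rewrite ffunE /pairf; case: eqP => [->//|].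
by case: k => [[|[|k]] hk] // ne; [case: ne|congr (s _)]; apply: val_inj.
Qed.

Lemma tcoef_app2 (A : 'End(tpow V 2)) t a b :
  tcoef (A t) (pairi a b) =
  \sum_(q : I * I) opcoef A (a, b) q * tcoef t (pairi q.1 q.2).
Proof.
rewrite {1}[t]delta_sum linear_sum tcoef_sum.
rewrite (reindex (fun p : I * I => pairi p.1 p.2)) /=; last first.
  exact/onW_bij/pairi_bij.
by apply: eq_bigr => q _; rewrite linearZ tcoefZ mulrC.
Qed.

Lemma opcoef_comp (A B : 'End(tpow V 2)) p q :
  opcoef (A \o B)%VF p q = \sum_c opcoef A p c * opcoef B c q.
Proof. by rewrite {1}/opcoef comp_lfunE tcoef_app2 -surjective_pairing. Qed.

Lemma opcoef_id p q : opcoef \1%VF p q = (p == q)%:R.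
Proof.
rewrite /opcoef id_lfunE tcoef_mktens.
by rewrite (inj_eq (bij_inj pairi_bij)).
Qed.

Lemma tens2_e (a b : I) : tens2 e`_a e`_b = delta (pairi a b).
Proof.
rewrite -[delta _]pure_vbasis; congr pure; apply/funext => k.
by rewrite ffunE /pairf; case: ifP.
Qed.

Lemma opcoef_tensop (B C : 'End(V)) p q : opcoef (tensop B C) p q =
  coord e p.1 (B e`_q.1) * coord e p.2 (C e`_q.2).
Proof.
rewrite /opcoef -tens2_e tensop_pure tcoef_mktens big_ord_recl big_ord1 /=.
by rewrite !ffunE.
Qed.

(* The (a, b) block of [A], as an operator on the second tensor factor. *)
Definition rho_fun (A : 'End(tpow V 2)) (a b : I) (v : V) : V :=
  \sum_(k : I) tcoef (A (tens2 e`_b v)) (pairi a k) *: e`_k.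

Definition rho (A : 'End(tpow V 2)) (a b : I) : 'End(V) := linfun (rho_fun A a b).

Lemma tens2_linear (v : V) : linear (tens2 v).
Proof.
move=> k u w; have E x : tens2 v x = pure (upd (pairf v 0) ord_max x).
  by congr pure; apply/funext => -[[|[|j]] hj].
by rewrite !E pure_upd.
Qed.

Lemma coord_rho A a b v k :
  coord e k (rho A a b v) = tcoef (A (tens2 e`_b v)) (pairi a k).
Proof.
rewrite linfunP => [|c u w].
  rewrite linear_sum (bigD1 k) //= big1 => [|j ne].
    by rewrite linearZ /= coord_e eqxx mulr1 addr0.
  by rewrite linearZ /= coord_e eq_sym (negbTE ne) mulr0.
rewrite /rho_fun scaler_sumr -big_split /=; apply: eq_bigr => j _.
by rewrite tens2_linear linearP tcoefP scalerDl scalerA.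
Qed.

Lemma coord_rho_e A (a b k l : I) :
  coord e k (rho A a b e`_l) = opcoef A (a, k) (b, l).
Proof. by rewrite coord_rho tens2_e. Qed.

(** The entries of R_{0i} act at site [i] only, which is why entries at distinct sites commute. *)
Lemma block_leg2 N (i : 'I_N) A :
  block (leg2 ord0 (lift ord0 i) A) = fun a b => leg1 i (rho A a b).
Proof.
apply/funext => a; apply/funext => b; apply/lfunP => t; apply: tensP => s.
rewrite blockE leg2E leg1E coord_rho consi0 consiS.
congr (tcoef (A _) _); apply: tensP => u; rewrite !tcoef_mktens.
rewrite big_ord_recl big_ord1 /= coord_e.
have -> : lift ord0 ord0 = ord_max :> 'I_2 by apply: val_inj.
rewrite linear_sum (bigD1 (u ord_max)) //= big1 => [|j ne]; last first.
  by rewrite linearZ /= coord_e eq_sym (negbTE ne) mulr0.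
rewrite linearZ /= coord_e eqxx mulr1 addr0 ffunE /upd /= ffunE /upd /=.
case: eqP => _; rewrite ?mul1r ?mul0r //; congr (tcoef t _).
by apply/ffunP => k; rewrite !ffunE /upd (inj_eq lift_inj) ffunE /upd /= consiS.
Qed.

Lemma leg2_opcoef N (i j : 'I_N) A t s : tcoef (leg2 i j A t) s =
  \sum_(q : I * I) opcoef A (s i, s j) q * tcoef t (updi (updi s i q.1) j q.2).
Proof.
rewrite leg2E tcoef_app2; apply: eq_bigr => q _; rewrite tcoef_mktens.
by rewrite !ffunE.
Qed.

End Tensors.

(** * The exchange relation for the monodromy matrix *)

Section Monodromy.
Variables (F : fieldType) (V : vectType F).
Local Notation I := 'I_(\dim {:V}).
Local Notation e := (vbasis {:V}).

Definition tri (a b c : I) : midx V 3 := [ffun k : 'I_3 => nth a [:: a; b; c] k].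

Lemma tri_inj a b c a' b' c' :
  (tri a b c == tri a' b' c') = [&& a == a', b == b' & c == c'].
Proof.
apply/eqP/and3P => [/ffunP E|[/eqP-> /eqP-> /eqP->] //].
by split; apply/eqP; [move: (E (@Ordinal 3 0 isT)) | move: (E (@Ordinal 3 1 isT))
  | move: (E (@Ordinal 3 2 isT))]; rewrite !ffunE.
Qed.

Lemma updi_tri01 a b c x y :
  updi (updi (tri a b c) (@Ordinal 3 0 isT) x) (@Ordinal 3 1 isT) y = tri x y c.
Proof. by apply/ffunP => -[[|[|[|k]]] hk] //; do !rewrite !ffunE /upd /=. Qed.

Lemma updi_tri02 a b c x y :
  updi (updi (tri a b c) (@Ordinal 3 0 isT) x) (@Ordinal 3 2 isT) y = tri x b y.
Proof. by apply/ffunP => -[[|[|[|k]]] hk] //; do !rewrite !ffunE /upd /=. Qed.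

Lemma updi_tri12 a b c x y :
  updi (updi (tri a b c) (@Ordinal 3 1 isT) x) (@Ordinal 3 2 isT) y = tri a x y.
Proof. by apply/ffunP => -[[|[|[|k]]] hk] //; do !rewrite !ffunE /upd /=. Qed.

Lemma sum_delta (J : finType) (f : J -> F) h : \sum_g f g * (g == h)%:R = f h.
Proof.
rewrite (bigD1 h) //= eqxx mulr1 big1 ?addr0 // => g /negbTE->.
by rewrite mulr0.
Qed.

Lemma sum_pair (f : I * I -> F) : \sum_p f p = \sum_a \sum_b f (a, b).
Proof. by rewrite pair_bigA; apply: eq_bigr => -[]. Qed.

(** Factors 1 and 2 of V^{⊗3} serve as the two auxiliary spaces and factor 3 as the site. The
    relation is the Yang-Baxter equation read off at the matrix entry with row (a, a', k) and column
    (b, b', l). *)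
Lemma rtt_rho (A B C : 'End(tpow V 2)) :
  let l1 : 'I_3 := @Ordinal 3 0 isT in
  let l2 : 'I_3 := @Ordinal 3 1 isT in
  let l3 : 'I_3 := @Ordinal 3 2 isT in
  (leg2 l1 l2 A \o leg2 l1 l3 B \o leg2 l2 l3 C =
   leg2 l2 l3 C \o leg2 l1 l3 B \o leg2 l1 l2 A)%VF ->
  rtt (opcoef A) (rho B) (rho C).
Proof.
move=> l1 l2 l3 ybe [a a'] [b b']; apply: eq_on_basis => k l.
have /(congr1 (fun f : 'End(tpow V 3) =>
  tcoef (f (delta (tri b b' l))) (tri a a' k))) := ybe.
have nth_tri x y w : (tri x y w l1 = x) * (tri x y w l2 = y) * (tri x y w l3 = w).
  by rewrite !ffunE.
(* After the Kronecker deltas are summed out, a pair [c] of auxiliary indices and one index [m] on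
   factor 3 remain. *)
have -> : tcoef ((leg2 l1 l2 A \o leg2 l1 l3 B \o leg2 l2 l3 C)%VF
      (delta (tri b b' l))) (tri a a' k) =
    \sum_c opcoef A (a, a') c *
      \sum_m opcoef B (c.1, k) (b, m) * opcoef C (c.2, m) (b', l).
  rewrite !comp_lfunE leg2_opcoef !nth_tri; apply: eq_bigr => c _.
  rewrite updi_tri01 leg2_opcoef !nth_tri; congr (_ * _).
  rewrite sum_pair exchange_big /=; apply: eq_bigr => m _.
  rewrite -[RHS](sum_delta
    (fun u => opcoef B (c.1, k) (u, m) * opcoef C (c.2, m) (b', l))).
  apply: eq_bigr => u _.
  rewrite updi_tri02 leg2_opcoef !nth_tri -mulrA; congr (_ * _).
  rewrite -[opcoef C _ (b', l)](sum_delta (opcoef C (c.2, m))) mulr_suml.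
  apply: eq_bigr => -[g g'] _; rewrite updi_tri12 tcoef_mktens tri_inj xpair_eqE.
  by rewrite -mulrA -natrM mulnb andbC.
have -> : tcoef ((leg2 l2 l3 C \o leg2 l1 l3 B \o leg2 l1 l2 A)%VF
      (delta (tri b b' l))) (tri a a' k) =
    \sum_c opcoef A c (b, b') *
      \sum_m opcoef C (a', k) (c.2, m) * opcoef B (a, m) (c.1, l).
  rewrite !comp_lfunE leg2_opcoef !nth_tri.
  rewrite sum_pair [RHS]sum_pair [RHS]exchange_big /=.
  apply: eq_bigr => w _.
  under [RHS]eq_bigr => u _ do rewrite mulr_sumr.
  rewrite [RHS]exchange_big /=; apply: eq_bigr => m _.
  rewrite updi_tri12 leg2_opcoef !nth_tri mulr_sumr sum_pair.
  apply: eq_bigr => u _.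
  rewrite -[RHS](sum_delta (fun m' => opcoef A (u, w) (b, b') *
    (opcoef C (a', k) (w, m) * opcoef B (a, m) (u, m')))).
  apply: eq_bigr => m' _; rewrite updi_tri02 leg2_opcoef !nth_tri.
  rewrite -[opcoef A _ (b, b')](sum_delta (opcoef A (u, w))) !mulr_suml !mulr_sumr.
  apply: eq_bigr => -[g g'] _; rewrite updi_tri01 tcoef_mktens tri_inj xpair_eqE.
  rewrite andbA -mulnb natrM; ring.
move=> E; rewrite !sum_lfunE !linear_sum /=.
transitivity (\sum_c opcoef A (a, a') c *
      \sum_m opcoef B (c.1, k) (b, m) * opcoef C (c.2, m) (b', l)).
  apply: eq_bigr => c _; rewrite scale_lfunE linearZ /= coord_comp.
  by congr (_ * _); apply: eq_bigr => m _; rewrite !coord_rho_e.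
rewrite E; apply: eq_bigr => c _; rewrite scale_lfunE linearZ /= coord_comp.
by congr (_ * _); apply: eq_bigr => m _; rewrite !coord_rho_e.
Qed.

Variable N : nat.
Implicit Type X : 'I_N -> 'End(tpow V 2).

Definition chain X (s : seq 'I_N) : 'End(tpow V N.+1) :=
  \big[@comp_lfun _ _ _ _ / \1%VF]_(i <- s) leg2 ord0 (lift ord0 i) (X i).

(** The entries of the chain are built from operators at the sites listed in [s], so by induction an
    operator at another site passes through them. *)
Lemma leg1_block_chain X s i B a b : i \notin s ->
  (leg1 i B \o block (chain X s) a b = block (chain X s) a b \o leg1 i B)%VF.
Proof.
elim: s a b => [|j s IHs] a b; rewrite /chain ?big_nil ?big_cons.
  by move=> _; rewrite block_id /scalmx -comp_lfunZl -comp_lfunZr comp_lfun1l comp_lfun1r.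
rewrite inE negb_or => /andP[ij /IHs comm].
rewrite block_comp block_leg2 /mprod comp_lfun_suml comp_lfun_sumr.
apply: eq_bigr => c _; rewrite comp_lfunA leg1_comm // -!comp_lfunA.
by rewrite -/(chain X s) comm.
Qed.

(** Induction on [s] by [rtt_mprod]: as [s] has no repetition, the site of its head is absent from
    its tail, which gives the required commutations. *)
Lemma rtt_block_chain r X Y s : uniq s ->
  (forall i, rtt r (rho (X i)) (rho (Y i))) ->
  rtt r (block (chain X s)) (block (chain Y s)).
Proof.
move=> us h; elim: s us => [_|i s IHs /= /andP[his us]];
  rewrite /chain ?big_nil ?big_cons.
  rewrite block_id; apply: rtt_scalmx => -[p p'] [q q'] /=.
  transitivity (r (p, p') (q, q')).
    rewrite -[RHS](sum_delta (r (p, p'))); apply: eq_bigr => -[c c'] _.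
    by rewrite xpair_eqE -natrM mulnb.
  rewrite -[LHS](sum_delta (fun c => r c (q, q'))); apply: eq_bigr => -[c c'] _.
  by rewrite xpair_eqE -natrM mulnb /= [c == p]eq_sym [c' == p']eq_sym.
rewrite !block_comp !block_leg2; apply: rtt_mprod.
(* [leg1 i] is linear and multiplicative, so it transports the one-site relation to site [i]. *)
- move=> p q; have := congr1 (leg1 i) (h i p q); rewrite !linear_sum /=.
  under eq_bigr => c _ do rewrite linearZ /= leg1_comp.
  by move=> ->; apply: eq_bigr => c _; rewrite linearZ /= leg1_comp.
- exact: IHs.
- by move=> a b c d; rewrite leg1_block_chain.
- by move=> a b c d; rewrite leg1_block_chain.
Qed.

(** D_0 is one more factor: its entries are multiples of the identity, and its exchange relation is
    the commutation of [r] with D ⊗ D. *)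
Lemma rtt_monodromy r X Y (D : 'End(V)) s : uniq s ->
  (forall i, rtt r (rho (X i)) (rho (Y i))) ->
  (forall p q, \sum_c r p c * opcoef (tensop D D) c q =
               \sum_c opcoef (tensop D D) p c * r c q) ->
  rtt r (block (leg1 ord0 D \o chain X s)%VF) (block (leg1 ord0 D \o chain Y s)%VF).
Proof.
move=> us h hD; rewrite !block_comp !block_leg1; apply: rtt_mprod.
- apply: rtt_scalmx => p q; transitivity (\sum_c r p c * opcoef (tensop D D) c q).
    by apply: eq_bigr => c _; rewrite opcoef_tensop.
  by rewrite hD; apply: eq_bigr => c _; rewrite opcoef_tensop mulrC.
- exact: rtt_block_chain.
- by move=> a b c d; rewrite /scalmx -comp_lfunZl -comp_lfunZr comp_lfun1l comp_lfun1r.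
- by move=> a b c d; rewrite /scalmx -comp_lfunZl -comp_lfunZr comp_lfun1l comp_lfun1r.
Qed.

Lemma transfer_comm (z : 'I_N -> F) (R : F -> 'End(tpow V 2)) (D : 'End(V))
    (G : 'End(tpow V 2)) x y :
  (forall i, z i != 0) ->
  (forall i, yang_baxter R (x / z i) (y / z i)) ->
  (R (x / y) \o tensop D D = tensop D D \o R (x / y))%VF ->
  (G \o R (x / y) = \1)%VF -> (R (x / y) \o G = \1)%VF ->
  (transfer z R D x \o transfer z R D y = transfer z R D y \o transfer z R D x)%VF.
Proof.
move=> hz ybe hD GR RG; rewrite /transfer !ptrace0_block.
apply: (@rtt_trace_comm _ _ _ (opcoef (R (x / y))) (opcoef G)).
- by move=> p q; rewrite -opcoef_comp RG opcoef_id.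
- by move=> p q; rewrite -opcoef_comp GR opcoef_id.
apply: (rtt_monodromy (s := rev (enum 'I_N))
  (X := fun i => R (x / z i)) (Y := fun i => R (y / z i))).
- by rewrite rev_uniq enum_uniq.
- move=> i; apply: rtt_rho; move: (ybe i); rewrite /yang_baxter.
  (* The ratio of x / z_i and y / z_i is x / y at every site, so a single [r] serves the whole
     chain. *)
  by rewrite invfM invrK mulrACA mulVf ?hz // mulr1.
- by move=> p q; rewrite -!opcoef_comp hD.
Qed.

End Monodromy.

(** * Vector-valued polynomial functions and their zeros *)

Import passmx.

Section PolynomialFunctions.
Variable F : numFieldType.

(** With scalar polynomials and constant vectors, composition of operators reduces to products of
    scalar polynomials, and vanishing can be tested coordinate by coordinate. *)
Definition polyfun (E : vectType F) (f : F -> E) : Prop :=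
  exists (J : finType) (p : J -> {poly F}) (u : J -> E),
    forall x, f x = \sum_j (p j).[x] *: u j.

Lemma polyfun_affine (E : vectType F) (A B : E) c (h : F -> F) :
  (forall x, h x = x * c) -> polyfun (fun x => A + h x *: B).
Proof.
move=> hc; exists bool, (fun b => if b then 1 else c *: 'X),
  (fun b => if b then A else B) => x.
by rewrite big_bool /= !hornerE scale1r mulrC hc.
Qed.

Lemma polyfun_cst (E : vectType F) (A : E) : polyfun (fun=> A).
Proof.
exists (ordinal 1), (fun=> 1), (fun=> A) => x.
by rewrite big_ord1 hornerE scale1r.
Qed.

Lemma polyfun_linear (E E' : vectType F) (L : {linear E -> E'}) f :
  polyfun f -> polyfun (fun x => L (f x)).
Proof.
move=> [J [p [u h]]]; exists J, p, (fun j => L (u j)) => x.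
by rewrite h linear_sum; apply: eq_bigr => j _; rewrite linearZ.
Qed.

Lemma polyfun_sub (E : vectType F) (f g : F -> E) :
  polyfun f -> polyfun g -> polyfun (fun x => f x - g x).
Proof.
move=> [J [p [u h]]] [J' [p' [u' h']]].
exists (J + J')%type, (fun j => match j with inl j => p j | inr j => p' j end),
  (fun j => match j with inl j => u j | inr j => - u' j end) => x.
rewrite big_sumType /= h h' -sumrN; congr (_ + _).
by apply: eq_bigr => j _; rewrite scalerN.
Qed.

Lemma polyfun_comp (W : vectType F) (f g : F -> 'End(W)) :
  polyfun f -> polyfun g -> polyfun (fun x => (f x \o g x)%VF).
Proof.
move=> [J [p [u h]]] [J' [p' [u' h']]].
exists (J * J')%type, (fun j => p j.1 * p' j.2), (fun j => (u j.1 \o u' j.2)%VF) => x.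
rewrite h h' comp_lfun_suml.
under eq_bigr => j _ do rewrite comp_lfun_sumr.
rewrite pair_bigA /=; apply: eq_bigr => j _.
by rewrite hornerM -comp_lfunZl -comp_lfunZr scalerA.
Qed.

Lemma poly_seq_eq0 (q : {poly F}) (a : nat -> F) :
  injective a -> (forall n, q.[a n] = 0) -> q = 0.
Proof.
move=> inja qa; apply/eqP/contraT => q0.
(* A nonzero [q] has fewer than [size q] distinct roots. *)
have roots : all (root q) (map a (iota 0 (size q))).
  by apply/allP => _ /mapP[n _ ->]; rewrite rootE qa.
have := max_poly_roots q0 roots.
by rewrite map_inj_uniq ?iota_uniq // size_map size_iota ltnn => /(_ isT).
Qed.

Lemma polyfun_coord (E : vectType F) (f : F -> E) b : polyfun f ->
  exists q : {poly F}, forall x, coord (vbasis {:E}) b (f x) = q.[x].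
Proof.
move=> [J [p [u h]]]; exists (\sum_j coord (vbasis {:E}) b (u j) *: p j) => x.
rewrite h linear_sum horner_sum; apply: eq_bigr => j _.
by rewrite linearZ hornerZ mulrC.
Qed.

Lemma coord_eq0 (E : vectType F) (v : E) :
  (forall b, coord (vbasis {:E}) b v = 0) -> v = 0.
Proof.
move=> v0; rewrite (coord_vbasis (memvf v)) big1 // => b _.
by rewrite v0 scale0r.
Qed.

Lemma polyfun_seq_eq0 (E : vectType F) (f : F -> E) (a : nat -> F) :
  polyfun f -> injective a -> (forall n, f (a n) = 0) -> forall x, f x = 0.
Proof.
move=> pf inja fa x; apply: coord_eq0 => b; have [q hq] := polyfun_coord b pf.
rewrite hq (poly_seq_eq0 (q := q) inja) ?horner0 // => n.
by rewrite -hq fa linear0.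
Qed.

(** The product of [Q] with a coordinate polynomial of [f] vanishes at every natural number, hence
    is zero, and [Q] cancels. *)
Lemma polyfun_nonroot_eq0 (E : vectType F) (f : F -> E) (Q : {poly F}) :
  polyfun f -> Q != 0 -> (forall x, Q.[x] != 0 -> f x = 0) -> forall x, f x = 0.
Proof.
move=> pf Q0 fQ x; apply: coord_eq0 => b; have [q hq] := polyfun_coord b pf.
suff /eqP : Q * q = 0.
  by rewrite hq mulf_eq0 (negbTE Q0) => /eqP->; rewrite horner0.
apply: (@poly_seq_eq0 _ (fun n => n%:R)) => [m n /eqP|n].
  by rewrite eqr_nat => /eqP.
rewrite hornerM; have [->|/fQ fn] := eqVneq Q.[n%:R] 0; first by rewrite mul0r.
by rewrite -hq fn linear0 mulr0.
Qed.

(** [Q] is the determinant of the pencil; the left inverse at x = 1 keeps it from vanishing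
    there. *)
Lemma invertible_pencil (W : vectType F) (A B G : 'End(W)) :
  (G \o (A + B) = \1)%VF ->
  exists Q : {poly F}, Q.[1] != 0 /\ forall x, Q.[x] != 0 ->
    exists H, (H \o (A + x *: B) = \1)%VF /\ ((A + x *: B) \o H = \1)%VF.
Proof.
set e := vbasis {:W} => GAB.
have be : basis_of {:W} e := vbasisP _.
have fe : free e := basis_free be.
pose M := mxof e e; pose MP := map_mx polyC (M A) + 'X *: map_mx polyC (M B).
have MPx x : (\det MP).[x] = \det (M (A + x *: B)).
  have -> : M (A + x *: B) = M A + x *: M B by rewrite /M linearD linearZ.
  rewrite /MP -horner_evalE -det_map_mx; move: (M A) (M B) => a b.
  congr (\det _); apply/matrixP => i j.
  by rewrite !mxE /= horner_evalE !hornerE.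
exists (\det MP); split.
  rewrite MPx scale1r; apply: contraTneq isT => d0.
  have := congr1 (fun f => \det (M f)) GAB.
  rewrite /M (mxof_comp _ _ be) // mxof1 // det_mulmx -/M d0 mul0r det1 => /eqP.
  by rewrite eq_sym oner_eq0.
move=> x; rewrite MPx -unitfE -[_ \is a GRing.unit]/(_ \in unitmx) => Mu.
exists (hommx e e (invmx (M (A + x *: B)))).
(* [mxof] follows the row-vector convention and reverses composition, so the left inverse comes from
   [mulmxV] and the right one from [mulVmx]. *)
split; apply: (can_inj (mxofK be be)); rewrite (mxof_comp _ _ be) // mxof1 // hommxK //.
  by rewrite mulmxV.
by rewrite mulVmx.
Qed.

Lemma polyfun_near_eq0 (E : vectType F) (f : F -> E) (x0 : F^o) :
  polyfun f -> (\forall x \near x0, f x = 0) -> forall x, f x = 0.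
Proof.
move=> pf /nbhs_ballP[r /= r0 fr].
(* These points are distinct and, as n + 2 > 1, lie strictly inside the ball of radius [r]. *)
apply: (@polyfun_seq_eq0 E f (fun n => x0 + r / n.+2%:R)) => // [m n|n].
  move=> /addrI /(mulfI (lt0r_neq0 r0)) /invr_inj /eqP.
  by rewrite eqr_nat => /eqP[].
apply: fr; rewrite /ball /= opprD addrA subrr sub0r normrN.
rewrite gtr0_norm ?divr_gt0 ?ltr0n //.
by rewrite ltr_pdivrMr ?ltr0n // ltr_pMr // ltr1n.
Qed.

End PolynomialFunctions.

(** * Polynomial dependence of the transfer matrix on the spectral parameter *)

Section Transfer.
Variables (F : numFieldType) (V : vectType F).

Lemma flip_flip : (flip V \o flip V = \1)%VF.
Proof.
apply/lfunP => t; apply: tensP => s; rewrite comp_lfunE id_lfunE !flipE.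
congr (tcoef t _); apply/ffunP => k; rewrite !ffunE /pairf /=.
by case: k => [[|[|k]] hk] //=; congr (s _); apply: val_inj.
Qed.

Lemma leg2_linear N (i j : 'I_N) : linear (@leg2 F V N i j).
Proof.
move=> a A B; apply/lfunP => t; apply: tensP => s.
by rewrite add_lfunE scale_lfunE tcoefP !leg2E add_lfunE scale_lfunE tcoefP.
Qed.

HB.instance Definition _ N (i j : 'I_N) :=
  GRing.isLinear.Build F _ _ *:%R (@leg2 F V N i j) (@leg2_linear N i j).

Lemma ptrace0_linear N : linear (@ptrace0 F V N).
Proof.
move=> a A B; apply/lfunP => t; apply: tensP => s.
rewrite add_lfunE scale_lfunE tcoefP !ptrace0E mulr_sumr -big_split /=.
by apply: eq_bigr => c _; rewrite add_lfunE scale_lfunE tcoefP.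
Qed.

HB.instance Definition _ N :=
  GRing.isLinear.Build F _ _ *:%R (@ptrace0 F V N) (@ptrace0_linear N).

(** Each factor is affine in x, composition preserves [polyfun], and the partial trace is linear. *)
Lemma polyfun_transfer N (z : 'I_N -> F) (A B : 'End(tpow V 2)) D :
  polyfun (transfer z (fun x => A + x *: B) D).
Proof.
apply: (polyfun_linear (@ptrace0 F V N)).
apply: polyfun_comp; first exact: polyfun_cst.
elim: (rev _) => [|i s IHs].
  have -> : (fun x => \big[@comp_lfun _ _ _ _ / \1%VF]_(i <- [::])
      leg2 ord0 (lift ord0 i) (A + x / z i *: B)) = fun=> \1%VF.
    by apply/funext => x; rewrite big_nil.
  exact: polyfun_cst.
under eq_fun => x do rewrite big_cons.
apply: polyfun_comp => //.
by apply: (polyfun_linear (leg2 ord0 (lift ord0 i))); apply: polyfun_affine => x.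
Qed.

End Transfer.

(** * From generic validity to validity on a neighbourhood *)

Section Generic.
Variable K : realType.

(* A point outside the analytic subset has a neighbourhood outside it, because
   the subset is locally closed as a common zero locus. *)
Lemma generic_near (E : normedModType K[i]) (O : set E) (P : E -> Prop) :
  generic O P -> exists p0 : E, \forall p \near p0, O p /\ P p.
Proof.
move=> [A [[AO loc] AneO hP]].
have [p0 Op0 nAp0] : exists2 p0, O p0 & ~ A p0.
  apply: contrapT => h; apply: AneO; apply/seteqP; split=> // p Op.
  by apply: contrapT => nAp; apply: h; exists p.
exists p0; have [U [oU UO [m [f [df fA]]]]] := loc p0 Op0.
have Up0 : U p0 by case: oU.
have [i fi0] : exists i, f i p0 <> 0.
  apply: contrapT => h; apply: nAp0; apply/fA => // i.
  by apply: contrapT => fi; apply: h; exists i.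
have nU : nbhs p0 U by apply: open_nbhs_nbhs.
have nf : \forall p \near p0, f i p != 0.
  have cf : {for p0, continuous (f i)} := differentiable_continuous (df i p0 Up0).
  by apply: cvgr_neq0 cf _; apply/eqP.
near=> p; have Up : U p by near: p.
have Op := UO _ Up; split=> //; apply: hP => // Ap.
have fp : f i p != 0 by near: p.
by move/(fA p Up): Ap => /(_ i) fp0; rewrite fp0 eqxx in fp.
Unshelve. all: by end_near.
Qed.

End Generic.

(** * Extension of the identities to all values of the parameters *)

Section Extension.
Variables (F : numFieldType) (V : vectType F) (A B : 'End(tpow V 2)).
Local Notation R := (fun x => A + x *: B).

Lemma polyfun_leg2 (i j : 'I_3) c (h : F -> F) :
  (forall x, h x = x * c) -> polyfun (fun x => leg2 i j (A + h x *: B)).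
Proof. by move=> hc; apply/polyfun_linear/(polyfun_affine _ _ hc). Qed.

Lemma polyfun_exchange (W : vectType F) (L1 L2 L3 : F -> 'End(W)) :
  polyfun L1 -> polyfun L2 -> polyfun L3 ->
  polyfun (fun x => (L1 x \o L2 x \o L3 x)%VF - (L3 x \o L2 x \o L1 x)%VF).
Proof.
move=> p1 p2 p3.
by apply: polyfun_sub; apply: polyfun_comp => //; apply: polyfun_comp.
Qed.

Lemma polyfun_commutator (W : vectType F) (f g : F -> 'End(W)) :
  polyfun f -> polyfun g ->
  polyfun (fun x => (f x \o g x)%VF - (g x \o f x)%VF).
Proof. by move=> pf pg; apply: polyfun_sub; apply: polyfun_comp. Qed.

Lemma commute_everywhere (D : 'End(V)) (x0 : F^o) :
  (\forall x \near x0, (R x \o tensop D D = tensop D D \o R x)%VF) ->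
  forall x, (R x \o tensop D D = tensop D D \o R x)%VF.
Proof.
move=> nx0 x; apply/eqP; rewrite -subr_eq0; apply/eqP.
move: x; apply: (@polyfun_near_eq0 _ _ _ x0); last first.
  by apply: filterS nx0 => x ->; rewrite subrr.
have pR : polyfun R.
  by apply: (polyfun_affine _ _ (c := 1)) => t; rewrite mulr1.
exact: (polyfun_commutator (g := fun=> tensop D D) pR (polyfun_cst _)).
Qed.

(* Substituting x = u y turns R(x / y) into R(u), so that the Yang-Baxter
   equation becomes polynomial in u and in y. *)
Lemma yang_baxter_everywhere (p0 : (F^o * F^o)%type) :
  (\forall p \near p0, p.2 != 0 /\ yang_baxter R p.1 p.2) ->
  forall x y : F, y != 0 -> yang_baxter R x y.
Proof.
case: p0 => x0 y0 [[U1 U2] /= [nU1 nU2] U12] x y y0n.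
pose l1 : 'I_3 := @Ordinal 3 0 isT.
pose l2 : 'I_3 := @Ordinal 3 1 isT.
pose l3 : 'I_3 := @Ordinal 3 2 isT.
(* Here u = x / y and v = y. The factors 1 give every argument the shape, variable times constant,
   that [polyfun_leg2] asks for. *)
pose f (u v : F) :=
  (leg2 l1 l2 (A + (u * 1) *: B) \o leg2 l1 l3 (A + (u * v) *: B)
     \o leg2 l2 l3 (A + (v * 1) *: B))%VF
  - (leg2 l2 l3 (A + (v * 1) *: B) \o leg2 l1 l3 (A + (u * v) *: B)
     \o leg2 l1 l2 (A + (u * 1) *: B))%VF.
have ybf (u v : F) : v != 0 -> yang_baxter R (u * v) v <-> f u v = 0.
  move=> v0; rewrite /yang_baxter /f (mulfK v0 u) (mulr1 u) (mulr1 v).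
  by split=> /eqP E; apply/eqP; move: E; rewrite subr_eq0.
suff f0 u v : f u v = 0 by rewrite -(divfK y0n x) ybf.
move: v; apply: (@polyfun_near_eq0 _ _ (f u) y0) => [|].
  apply: polyfun_exchange; first exact: polyfun_cst.
    by apply: (polyfun_leg2 _ _ (c := u)) => v; rewrite mulrC.
  by apply: (polyfun_leg2 _ _ (c := 1)) => v.
apply: filterS nU2 => v Uv.
have v0 : v != 0 by have [] := U12 (x0, v) (conj (nbhs_singleton nU1) Uv).
(* With [v] fixed near [y0], the new variable w = u v is the original x, and the equation is known
   for w near [x0]. *)
rewrite -(mulfK v0 u); move: (u * v).
apply: (@polyfun_near_eq0 _ _ (fun w => f (w / v) v) x0) => [|].
  apply: polyfun_exchange; last exact: polyfun_cst.
    by apply: (polyfun_leg2 _ _ (c := v^-1 * 1)) => w; rewrite mulrA.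
  by apply: (polyfun_leg2 _ _ (c := v^-1 * v)) => w; rewrite mulrA.
apply: filterS nU1 => w Uw; apply/(ybf _ _ v0); rewrite (divfK v0).
by have [] := U12 (w, v) (conj Uw Uv).
Qed.

(** [transfer_comm] covers y nonzero with R(x / y) invertible. The commutator is polynomial in each
    variable separately, so y = 0 is recovered from nonzero y, and, for fixed nonzero y, the
    remaining x from those outside the zeros of a determinant. *)
Lemma transfer_comm_everywhere N (z : 'I_N -> F) (D : 'End(V)) (m : F) :
  (forall i, z i != 0) ->
  (forall x y : F, y != 0 -> yang_baxter R x y) ->
  (forall x, (R x \o tensop D D = tensop D D \o R x)%VF) ->
  m != 0 -> A + B = m *: flip V ->
  forall x y, (transfer z R D x \o transfer z R D y =
               transfer z R D y \o transfer z R D x)%VF.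
Proof.
move=> hz ybe comm m0 Rm.
(* The flip is an involution, so A + B squares to m^2 times the identity. *)
have GR : (m^-2 *: (A + B) \o (A + B) = \1)%VF.
  rewrite Rm -!comp_lfunZl -comp_lfunZr flip_flip !scalerA -mulrA.
  by rewrite mulVf ?scale1r // mulf_neq0.
have [Q [Q1 hQ]] := invertible_pencil GR.
pose T := transfer z (fun x => A + x *: B) D.
have pT : polyfun T by exact: polyfun_transfer.
suff C x y : (T x \o T y)%VF - (T y \o T x)%VF = 0.
  by move=> x y; apply/eqP; rewrite -subr_eq0; apply/eqP; exact: C.
move: y; apply: (@polyfun_nonroot_eq0 _ _ _ 'X).
- exact: (polyfun_commutator (f := fun=> T x) (polyfun_cst _) pT).
- by rewrite polyX_eq0.
move=> y; rewrite hornerX => y0.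
(* As a polynomial in x, Q(x / y) is nonzero: its value at x = y is Q(1). *)
move: x; apply: (@polyfun_nonroot_eq0 _ _ _ (Q \Po (y^-1 *: 'X))).
- exact: (polyfun_commutator (g := fun=> T y) pT (polyfun_cst _)).
- apply: contra_neq Q1 => /(congr1 (horner^~ y)).
  by rewrite horner_comp !hornerE mulVf.
move=> x; rewrite horner_comp !hornerE mulrC => /hQ [H [HR RH]].
apply/eqP; rewrite subr_eq0; apply/eqP.
have ybi i : yang_baxter R (x / z i) (y / z i).
  by apply: ybe; rewrite mulf_neq0 ?invr_eq0.
exact: (transfer_comm hz ybi (comm _) HR RH).
Qed.

End Extension.

Theorem theorem4p1 (K : realType) (V : vectType K[i]) (N : nat)
  (z : 'I_N -> K[i]) (R : K[i] -> 'End(tpow V 2)) (D : 'End(V))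
  (hN : (1 <= N)%N)
  (hz : forall i, z i != 0)
  (hR : mer_End R)
  (h1 : @generic K (K[i]^o * K[i]^o)%type [set p | p.2 != 0]
          (fun p => yang_baxter R p.1 p.2))
  (h2 : @generic K K[i]^o setT
          (fun x => (R x \o tensop D D = tensop D D \o R x)%VF))
  (h3 : propto (R 1) (flip V))
  (h4 : poly_deg1 R)
  (h5 : exists (n : nat) (v : n.-tuple V),
     basis_of {:V} v /\
     forall a b : 'I_n,
     [/\ forall x, R x (tens2 (tnth v a) (tnth v b))
                     \in (<[tens2 (tnth v a) (tnth v b)]>
                          + <[tens2 (tnth v b) (tnth v a)]>)%VS,
         R 0 (tens2 (tnth v a) (tnth v b))
           \in (\sum_(p : 'I_n * 'I_n | (p.1 <= a)%N && (b <= p.2)%N)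
                  <[tens2 (tnth v p.1) (tnth v p.2)]>)%VS
       & D (tnth v a) \in <[tnth v a]>%VS]) :
  forall x y : K[i],
    (transfer z R D x \o transfer z R D y
     = transfer z R D y \o transfer z R D x)%VF.
Proof.
have [A [B [_ /funext RE]]] := h4; subst R.
have [p0 ybe] := generic_near h1; have [x0 comm] := generic_near h2.
(* R(1) is now A + B, so regularity says that A + B is a nonzero multiple of the flip. *)
have [m m0] := h3; rewrite scale1r => Rm.
apply: (transfer_comm_everywhere hz _ _ m0 Rm).
  exact: yang_baxter_everywhere ybe.
by apply: (@commute_everywhere _ _ _ _ _ x0); apply: filterS comm => x [].
Qed.
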